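(* Let $\mathbb{K}$ be a field of characteristic $0$, $q\in\mathbb{K}\setminus\{0\}$, and $p$ a polynomial in one variable over $\mathbb{K}$ with $p(0)\neq0$. Let $\mathcal{A}(p;q)$ and $\mathcal{B}(p;q)$ be the algebras defined in the context, with $\mathcal{B}(p;q)$ identified with the degree-zero subalgebra of $\mathcal{A}(p;q)$. Then the left (resp. right) $\mathcal{B}(p;q)$-module $\mathcal{A}(p;q)_1\oplus\mathcal{A}(p;q)_{-1}$ is free.
   Context: All algebras are associative and unital over $\mathbb{K}$. $\mathcal{A}(p;q)$ is the algebra generated by $x_+,x_-,z_+,z_-$ subject to the relations $$z_+z_-=z_-z_+,\quad x_+z_\pm=q^{-1}z_\pm x_+,\quad x_-z_\pm=q z_\pm x_-,\quad x_+x_-=p(z_+z_-),\quad x_-x_+=p(q^2z_-z_+).$$ It is $\mathbb{Z}$-graded by $|z_\pm|=|x_\pm|=\pm1$, with degree-$k$ component $\mathcal{A}(p;q)_k$. $\mathcal{B}(p;q)$ is the algebra generated by $x,y,z$ subject to the relations $xz=q^2zx$, $yz=q^{-2}zy$, $xy=q^2zp(q^2z)$, $yx=zp(z)$. It is identified with $\mathcal{A}(p;q)_0$ through the algebra isomorphism $x\mapsto x_-z_+$, $y\mapsto z_-x_+$, $z\mapsto z_-z_+$; each $\mathcal{A}(p;q)_k$ is then a left and right $\mathcal{B}(p;q)$-module by multiplication. *)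

(* Defs.v *)
From HB Require Import structures.
From mathcomp Require Import all_boot all_order all_algebra.
From mathcomp Require Import generic_quotient.
From mathcomp Require Import boolp.

Set Implicit Arguments.
Unset Strict Implicit.
Unset Printing Implicit Defensive.

Import GRing.Theory.

Local Open Scope ring_scope.
Local Open Scope quotient_scope.

(* An algebra given by generators and relations is the set of formal
   K-algebra expressions in the generators, modulo the least congruence that
   contains the relations and validates the axioms of associative unital
   K-algebras; see [palg_lift] for the universal property. *)
Section Presentation.
Variables (K : fieldType) (G : Type).

Inductive term :=
  | Sca of K
  | Gen of G
  | Add of term & term
  | Mul of term & term.

HB.instance Definition _ := gen_eqMixin term.
HB.instance Definition _ := gen_choiceMixin term.

Variable rel : term -> term -> Prop.

Inductive congr : term -> term -> Prop :=
  | congr_rel s t : rel s t -> congr s t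
  | congr_refl t : congr t t
  | congr_sym s t : congr s t -> congr t s
  | congr_trans s t u : congr s t -> congr t u -> congr s u
  | congr_Add s s' t t' :
      congr s s' -> congr t t' -> congr (Add s t) (Add s' t')
  | congr_Mul s s' t t' :
      congr s s' -> congr t t' -> congr (Mul s t) (Mul s' t')
  | congr_addA s t u : congr (Add s (Add t u)) (Add (Add s t) u)
  | congr_addC s t : congr (Add s t) (Add t s)
  | congr_add0 t : congr (Add (Sca 0) t) t
  | congr_addN t : congr (Add (Mul (Sca (-1)) t) t) (Sca 0)
  | congr_mulA s t u : congr (Mul s (Mul t u)) (Mul (Mul s t) u)
  | congr_mul1l t : congr (Mul (Sca 1) t) t
  | congr_mulDl s t u : congr (Mul (Add s t) u) (Add (Mul s u) (Mul t u))
  | congr_mulDr s t u : congr (Mul s (Add t u)) (Add (Mul s t) (Mul s u))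
  | congr_ScaD a b : congr (Sca (a + b)) (Add (Sca a) (Sca b))
  | congr_ScaM a b : congr (Sca (a * b)) (Mul (Sca a) (Sca b))
  | congr_ScaC a t : congr (Mul (Sca a) t) (Mul t (Sca a)).

Definition congrb (s t : term) : bool := `[< congr s t >].

Lemma congrb_equiv : equiv_class_of congrb.
Proof.
split=> [t|s t|t s u]; first exact/asboolP/congr_refl.
  by apply/asboolP/asboolP=> /congr_sym.
by move=> /asboolP st /asboolP tu; apply/asboolP; apply: congr_trans tu.
Qed.

Canonical congr_equiv : equiv_rel term := EquivRelPack congrb_equiv.

Definition palg : Type := {eq_quot congr_equiv}.

HB.instance Definition _ := Choice.on palg.
HB.instance Definition _ := EqQuotient.on palg.

Definition cls (t : term) : palg := \pi_palg t.

Lemma clsP s t : cls s = cls t <-> congr s t.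
Proof.
split=> [/eqP|st]; first by rewrite /cls eqmodE => /asboolP.
by apply/eqP; rewrite /cls eqmodE; apply/asboolP.
Qed.

Lemma repr_cls t : congr (repr (cls t)) t.
Proof. by apply/clsP; rewrite /cls reprK. Qed.

Lemma cls_ind (P : palg -> Prop) : (forall t, P (cls t)) -> forall x, P x.
Proof. by move=> Pt x; rewrite -[x]reprK; apply: Pt. Qed.

Definition palg_add (x y : palg) : palg := cls (Add (repr x) (repr y)).
Definition palg_mul (x y : palg) : palg := cls (Mul (repr x) (repr y)).
Definition palg_scale (a : K) (x : palg) : palg := cls (Mul (Sca a) (repr x)).
Definition palg_opp (x : palg) : palg := palg_scale (-1) x.

Let addE s t : palg_add (cls s) (cls t) = cls (Add s t).
Proof. by apply/clsP/congr_Add; apply: repr_cls. Qed.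
Let mulE s t : palg_mul (cls s) (cls t) = cls (Mul s t).
Proof. by apply/clsP/congr_Mul; apply: repr_cls. Qed.
Let scaleE a t : palg_scale a (cls t) = cls (Mul (Sca a) t).
Proof. by apply/clsP/congr_Mul; [apply: congr_refl | apply: repr_cls]. Qed.

Let addA : associative palg_add.
Proof.
elim/cls_ind=> s; elim/cls_ind=> t; elim/cls_ind=> u.
by rewrite !addE; apply/clsP/congr_addA.
Qed.
Let addC : commutative palg_add.
Proof.
by elim/cls_ind=> s; elim/cls_ind=> t; rewrite !addE; apply/clsP/congr_addC.
Qed.
Let add0 : left_id (cls (Sca 0)) palg_add.
Proof. by elim/cls_ind=> s; rewrite !addE; apply/clsP/congr_add0. Qed.
Let addN : left_inverse (cls (Sca 0)) palg_opp palg_add.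
Proof.
by elim/cls_ind=> s; rewrite /palg_opp scaleE addE; apply/clsP/congr_addN.
Qed.

HB.instance Definition _ := GRing.isZmodule.Build palg addA addC add0 addN.

Lemma cls0 : cls (Sca 0) = 0. Proof. by []. Qed.
Lemma clsD s t : cls (Add s t) = cls s + cls t.
Proof. by rewrite -addE. Qed.

Let mulA : associative palg_mul.
Proof.
elim/cls_ind=> s; elim/cls_ind=> t; elim/cls_ind=> u.
by rewrite !mulE; apply/clsP/congr_mulA.
Qed.
Let mul1x : left_id (cls (Sca 1)) palg_mul.
Proof. by elim/cls_ind=> s; rewrite !mulE; apply/clsP/congr_mul1l. Qed.
Let mulx1 : right_id (cls (Sca 1)) palg_mul.
Proof.
elim/cls_ind=> s; rewrite !mulE; apply/clsP/(congr_trans _ (congr_mul1l s)).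
exact/congr_sym/congr_ScaC.
Qed.
Let mulDl : left_distributive palg_mul +%R.
Proof.
elim/cls_ind=> s; elim/cls_ind=> t; elim/cls_ind=> u.
by rewrite -clsD !mulE -clsD; apply/clsP/congr_mulDl.
Qed.
Let mulDr : right_distributive palg_mul +%R.
Proof.
elim/cls_ind=> s; elim/cls_ind=> t; elim/cls_ind=> u.
by rewrite -clsD !mulE -clsD; apply/clsP/congr_mulDr.
Qed.

HB.instance Definition _ :=
  GRing.Zmodule_isPzRing.Build palg mulA mul1x mulx1 mulDl mulDr.

Lemma cls1 : cls (Sca 1) = 1. Proof. by []. Qed.
Lemma clsM s t : cls (Mul s t) = cls s * cls t.
Proof. by rewrite -mulE. Qed.

Let scaleM a x : palg_scale a x = cls (Sca a) * x.
Proof. by elim/cls_ind: x => s; rewrite scaleE clsM. Qed.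

Let scaleA a b (x : palg) :
  palg_scale a (palg_scale b x) = palg_scale (a * b) x.
Proof.
rewrite !scaleM mulrA -clsM; congr (_ * _); apply/clsP/congr_sym.
exact: congr_ScaM.
Qed.
Let scale1 : left_id 1 palg_scale.
Proof. by move=> x; rewrite scaleM cls1 mul1r. Qed.
Let scaleDr : right_distributive palg_scale +%R.
Proof. by move=> a x y; rewrite !scaleM mulrDr. Qed.
Let scaleDl x : {morph palg_scale^~ x : a b / a + b}.
Proof.
move=> a b; rewrite !scaleM -mulrDl -clsD; congr (_ * _).
exact/clsP/congr_ScaD.
Qed.

HB.instance Definition _ :=
  GRing.Zmodule_isLmodule.Build K palg scaleA scale1 scaleDr scaleDl.

Lemma clsZ a t : cls (Mul (Sca a) t) = a *: cls t.
Proof. by rewrite -[RHS]/(palg_scale a (cls t)) scaleE. Qed.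

Lemma cls_Sca a : cls (Sca a) = a *: (1 : palg).
Proof. by rewrite -[RHS]/(palg_scale a 1) scaleM mulr1. Qed.

Lemma palg_scaleAl a (x y : palg) : a *: (x * y) = (a *: x) * y.
Proof.
elim/cls_ind: x => s; elim/cls_ind: y => t.
by rewrite -clsM -!clsZ -clsM; apply/clsP/congr_mulA.
Qed.

Lemma palg_scaleAr a (x y : palg) : a *: (x * y) = x * (a *: y).
Proof.
elim/cls_ind: x => s; elim/cls_ind: y => t.
rewrite palg_scaleAl -!clsZ -!clsM; apply/clsP.
apply: (congr_trans (congr_Mul (congr_ScaC a s) (congr_refl t))).
exact/congr_sym/congr_mulA.
Qed.

Section UniversalProperty.
Variables (S : algType K) (f : G -> S).

Fixpoint eval (t : term) : S :=
  match t with
  | Sca a => a%:A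
  | Gen g => f g
  | Add s t => eval s + eval t
  | Mul s t => eval s * eval t
  end.

Definition palg_lift (x : palg) : S := eval (repr x).

Hypothesis f_rel : forall s t, rel s t -> eval s = eval t.

Lemma eval_congr s t : congr s t -> eval s = eval t.
Proof.
elim=> {s t} /=.
- exact: f_rel.
- by [].
- by move=> ? ? _ ->.
- by move=> ? ? ? _ -> _ ->.
- by move=> ? ? ? ? _ -> _ ->.
- by move=> ? ? ? ? _ -> _ ->.
- by move=> *; rewrite addrA.
- by move=> *; rewrite addrC.
- by move=> *; rewrite scale0r add0r.
- by move=> *; rewrite scaleN1r mulN1r addNr scale0r.
- by move=> *; rewrite mulrA.
- by move=> *; rewrite scale1r mul1r.
- by move=> *; rewrite mulrDl.
- by move=> *; rewrite mulrDr.
- by move=> *; rewrite scalerDl.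
- by move=> *; rewrite mulr_algl scalerA.
- by move=> *; rewrite mulr_algl mulr_algr.
Qed.

Lemma palg_liftE t : palg_lift (cls t) = eval t.
Proof. exact/eval_congr/repr_cls. Qed.

Lemma palg_lift_zmod : zmod_morphism palg_lift.
Proof.
elim/cls_ind=> s; elim/cls_ind=> t.
by rewrite -[- cls t]scaleN1r -clsZ -clsD !palg_liftE /= mulr_algl scaleN1r.
Qed.

Lemma palg_lift_monoid : monoid_morphism palg_lift.
Proof.
split; first by rewrite -cls1 palg_liftE /= scale1r.
by elim/cls_ind=> s; elim/cls_ind=> t; rewrite -clsM !palg_liftE.
Qed.

Lemma palg_lift_scalable : scalable palg_lift.
Proof.
by move=> a; elim/cls_ind=> s; rewrite -clsZ !palg_liftE /= mulr_algl.
Qed.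

Lemma palg_lift_gen g : palg_lift (cls (Gen g)) = f g.
Proof. by rewrite palg_liftE. Qed.

Lemma palg_lift_unique (h : palg -> S) :
    zmod_morphism h -> monoid_morphism h -> scalable h ->
  (forall g, h (cls (Gen g)) = f g) -> h =1 palg_lift.
Proof.
move=> hB [h1 hM] hZ hg; elim/cls_ind=> t; rewrite palg_liftE.
have h0 : h 0 = 0 by rewrite -(subrr 0) hB subrr.
have hD x y : h (x + y) = h x + h y.
  by rewrite -[y in LHS]opprK hB -[- y]add0r hB h0 add0r opprK.
elim: t => [a|g|s IHs t IHt|s IHs t IHt] /=.
- by rewrite cls_Sca hZ h1.
- exact: hg.
- by rewrite clsD hD IHs IHt.
- by rewrite clsM hM IHs IHt.
Qed.

End UniversalProperty.
End Presentation.

(* The expression [p(t)], written in Horner form. *)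
Definition horner_term (K : fieldType) (G : Type) (p : {poly K}) (t : term K G)
    : term K G :=
  foldr (fun c acc => Add (Sca G c) (Mul t acc)) (Sca G 0) p.

Lemma eval_horner (K : fieldType) (G : Type) (S : algType K) (f : G -> S)
    (p : {poly K}) (t : term K G) :
  eval f (horner_term p t) = horner_alg (eval f t) p.
Proof.
rewrite /horner_term -[in RHS](polyseqK p).
elim: (polyseq p) => [|c s IHs] /=; first by rewrite rmorph0 scale0r.
rewrite IHs cons_poly_def [Poly s * _]mulrC rmorphD rmorphM /=.
by rewrite horner_algC horner_algX addrC.
Qed.

Lemma eval_unique (K : fieldType) (G : Type) (S : algType K) (h : G -> S)
    (i : term K G -> S) (t : term K G) :
    (forall a, i (Sca G a) = a%:A) -> (forall g, i (Gen K g) = h g) ->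
    {morph i : s t / Add s t >-> s + t} -> {morph i : s t / Mul s t >-> s * t} ->
  i t = eval h t.
Proof.
move=> iS iG iD iM; elim: t => //= [s IHs t IHt|s IHs t IHt].
  by rewrite iD IHs IHt.
by rewrite iM IHs IHt.
Qed.

Section AlgebraA.
Variable K : fieldType.

Inductive A_gen := gxp | gxm | gzp | gzm.

HB.instance Definition _ := gen_eqMixin A_gen.

Local Notation "s ** t" := (Mul s t) (at level 40, left associativity).

Variables (p : {poly K}) (q : K).

Let xp := Gen K gxp.
Let xm := Gen K gxm.
Let zp := Gen K gzp.
Let zm := Gen K gzm.
Let sca := Sca A_gen : K -> term K A_gen.

Inductive A_rel : term K A_gen -> term K A_gen -> Prop :=
  | A_rel_zz : A_rel (zp ** zm) (zm ** zp)
  | A_rel_xpzp : A_rel (xp ** zp) (sca q^-1 ** zp ** xp)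
  | A_rel_xpzm : A_rel (xp ** zm) (sca q^-1 ** zm ** xp)
  | A_rel_xmzp : A_rel (xm ** zp) (sca q ** zp ** xm)
  | A_rel_xmzm : A_rel (xm ** zm) (sca q ** zm ** xm)
  | A_rel_xpxm : A_rel (xp ** xm) (horner_term p (zp ** zm))
  | A_rel_xmxp : A_rel (xm ** xp) (horner_term p (sca (q ^+ 2) ** zm ** zp)).

Definition algA : Type := palg A_rel.

HB.instance Definition _ := GRing.PzRing.on algA.
HB.instance Definition _ := GRing.Lmodule.on algA.

(* Nontriviality: x+ |-> p(0), x- |-> 1, z+, z- |-> 0 defines a morphism to K. *)
Lemma algA_neq0 : (1 : algA) != 0.
Proof.
pose f g : K^o := match g with gxp => p.[0] | gxm => 1 | _ => 0 end.
have hornerK x (r : {poly K}) : horner_alg (x : K^o) r = r.[x].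
  elim/poly_ind: r => [|r c IHr]; first by rewrite rmorph0 horner0.
  rewrite rmorphD rmorphM /= horner_algC horner_algX IHr !hornerE.
  by congr (_ + _); rewrite [LHS]mulr1.
have f_rel s t : A_rel s t -> eval f s = eval f t.
  by case; rewrite ?eval_horner /= ?hornerK /= ?(mulr0, mul0r, mulr1, mul1r).
apply/eqP=> /(congr1 (palg_lift f)).
rewrite (palg_lift_monoid f_rel).1.
have -> : (0 : algA) = cls A_rel (sca 0) by [].
by rewrite palg_liftE //= scale0r => /eqP; rewrite oner_eq0.
Qed.

HB.instance Definition _ := GRing.PzSemiRing_isNonZero.Build algA algA_neq0.
HB.instance Definition _ :=
  GRing.Lmodule_isLalgebra.Build K algA (@palg_scaleAl _ _ A_rel).
HB.instance Definition _ :=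
  GRing.Lalgebra_isAlgebra.Build K algA (@palg_scaleAr _ _ A_rel).

Definition A_val (g : A_gen) : algA := cls A_rel (Gen K g).

Local Notation x_p := (A_val gxp).
Local Notation x_m := (A_val gxm).
Local Notation z_p := (A_val gzp).
Local Notation z_m := (A_val gzm).

Lemma eval_A t : cls A_rel t = eval A_val t.
Proof.
apply: (eval_unique (i := cls A_rel : term K A_gen -> algA)) => //.
- exact: cls_Sca.
- exact: clsD.
- exact: clsM.
Qed.

Lemma eval_A_rel s t : A_rel s t -> eval A_val s = eval A_val t.
Proof. by rewrite -!eval_A => st; apply/clsP/congr_rel. Qed.

Lemma A_zz : z_p * z_m = z_m * z_p.
Proof. exact: (eval_A_rel A_rel_zz). Qed.
Lemma A_xpzp : x_p * z_p = q^-1 *: (z_p * x_p).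
Proof. by have /= -> := eval_A_rel A_rel_xpzp; rewrite mulr_algl scalerAl. Qed.
Lemma A_xpzm : x_p * z_m = q^-1 *: (z_m * x_p).
Proof. by have /= -> := eval_A_rel A_rel_xpzm; rewrite mulr_algl scalerAl. Qed.
Lemma A_xmzp : x_m * z_p = q *: (z_p * x_m).
Proof. by have /= -> := eval_A_rel A_rel_xmzp; rewrite mulr_algl scalerAl. Qed.
Lemma A_xmzm : x_m * z_m = q *: (z_m * x_m).
Proof. by have /= -> := eval_A_rel A_rel_xmzm; rewrite mulr_algl scalerAl. Qed.
Lemma A_xpxm : x_p * x_m = horner_alg (z_p * z_m) p.
Proof. by have /= -> := eval_A_rel A_rel_xpxm; rewrite eval_horner. Qed.
Lemma A_xmxp : x_m * x_p = horner_alg (q ^+ 2 *: (z_m * z_p)) p.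
Proof.
have /= -> := eval_A_rel A_rel_xmxp.
by rewrite eval_horner /= mulr_algl scalerAl.
Qed.

Definition A_deg (g : A_gen) : int :=
  match g with gxp | gzp => 1 | gxm | gzm => -1 end.

Definition A_word (w : seq A_gen) : algA := \prod_(g <- w) A_val g.
Definition A_wdeg (w : seq A_gen) : int := \sum_(g <- w) A_deg g.

(* The degree-k component is the span of the words of degree k. *)
Definition homog (k : int) : {pred algA} :=
  [pred a | `[< exists s : seq (K * seq A_gen),
     all (fun m => A_wdeg m.2 == k) s
     /\ a = \sum_(m <- s) m.1 *: A_word m.2 >]].

Lemma homogP k a :
  reflect (exists s : seq (K * seq A_gen),
     all (fun m => A_wdeg m.2 == k) s /\ a = \sum_(m <- s) m.1 *: A_word m.2)
    (a \in homog k).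
Proof. exact: asboolP. Qed.

Lemma homog0 k : 0 \in homog k.
Proof. by apply/homogP; exists [::]; rewrite big_nil. Qed.

Lemma homogD k : {in homog k &, forall a b, a + b \in homog k}.
Proof.
move=> _ _ /homogP[s [sk ->]] /homogP[t [tk ->]]; apply/homogP; exists (s ++ t).
by rewrite all_cat sk tk big_cat.
Qed.

Lemma homogZ k c : {in homog k, forall a, c *: a \in homog k}.
Proof.
move=> _ /homogP[s [sk ->]]; apply/homogP.
exists [seq (c * m.1, m.2) | m <- s]; rewrite all_map; split=> //.
by rewrite big_map scaler_sumr; apply: eq_bigr => m _; rewrite scalerA.
Qed.

Lemma homog_zmod k : zmod_closed (homog k).
Proof.
split=> [|a b ak bk]; first exact: homog0.
by rewrite homogD // -scaleN1r homogZ.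
Qed.

HB.instance Definition _ k := GRing.isZmodClosed.Build algA (homog k) (homog_zmod k).

Lemma homog_word w : A_word w \in homog (A_wdeg w).
Proof.
by apply/homogP; exists [:: (1, w)]; rewrite big_seq1 scale1r /= eqxx.
Qed.

Lemma homog_sum k (I : eqType) (r : seq I) (F : I -> algA) :
  (forall i, i \in r -> F i \in homog k) -> \sum_(i <- r) F i \in homog k.
Proof.
move=> Fk; rewrite big_seq; elim/big_ind: _ => //; first exact: homog0.
exact: homogD.
Qed.

Lemma homogM k l a b :
  a \in homog k -> b \in homog l -> a * b \in homog (k + l).
Proof.
move=> /homogP[s [/allP sk ->]] /homogP[t [/allP tl ->]].
rewrite mulr_suml; apply: homog_sum => m /sk/eqP mk.
rewrite mulr_sumr; apply: homog_sum => n /tl/eqP nl.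
rewrite -scalerAl -scalerAr !homogZ //.
by rewrite -mk -nl /A_wdeg /A_word -!big_cat; apply: homog_word.
Qed.

Definition A_comp (k : int) : Type := {a : algA | a \in homog k}.

HB.instance Definition _ k := [isSub of A_comp k for @sval _ _].
HB.instance Definition _ k := [Choice of A_comp k by <:].
HB.instance Definition _ k := [SubChoice_isSubZmodule of A_comp k by <:].

Inductive B_gen := gx | gy | gz.

Let x := Gen K gx.
Let y := Gen K gy.
Let z := Gen K gz.
Let scb := Sca B_gen : K -> term K B_gen.

Inductive B_rel : term K B_gen -> term K B_gen -> Prop :=
  | B_rel_xz : B_rel (x ** z) (scb (q ^+ 2) ** z ** x)
  | B_rel_yz : B_rel (y ** z) (scb (q ^- 2) ** z ** y)
  | B_rel_xy :
      B_rel (x ** y) (scb (q ^+ 2) ** z ** horner_term p (scb (q ^+ 2) ** z))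
  | B_rel_yx : B_rel (y ** x) (z ** horner_term p z).

Definition algB : Type := palg B_rel.

HB.instance Definition _ := GRing.PzRing.on algB.
HB.instance Definition _ := GRing.Lmodule.on algB.

(* Nontriviality: x, y, z |-> 0 defines a morphism to K. *)
Lemma algB_neq0 : (1 : algB) != 0.
Proof.
pose f (g : B_gen) : K^o := 0.
have f_rel s t : B_rel s t -> eval f s = eval f t.
  by case; rewrite /= ?(mulr0, mul0r).
apply/eqP=> /(congr1 (palg_lift f)).
rewrite (palg_lift_monoid f_rel).1.
have -> : (0 : algB) = cls B_rel (scb 0) by [].
by rewrite palg_liftE //= scale0r => /eqP; rewrite oner_eq0.
Qed.

HB.instance Definition _ := GRing.PzSemiRing_isNonZero.Build algB algB_neq0.
HB.instance Definition _ :=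
  GRing.Lmodule_isLalgebra.Build K algB (@palg_scaleAl _ _ B_rel).
HB.instance Definition _ :=
  GRing.Lalgebra_isAlgebra.Build K algB (@palg_scaleAr _ _ B_rel).

Definition B_val (g : B_gen) : algB := cls B_rel (Gen K g).

(* The identification of B with the degree-zero part of A. *)
Definition BA_gen (g : B_gen) : algA :=
  match g with gx => x_m * z_p | gy => z_m * x_p | gz => z_m * z_p end.

Lemma horner_alg_twist (a u v : algA) (r : {poly K}) :
  a * u = v * a -> a * horner_alg u r = horner_alg v r * a.
Proof.
move=> au; elim/poly_ind: r => [|r c IHr]; first by rewrite !rmorph0 mulr0 mul0r.
rewrite !rmorphD !rmorphM /= !horner_algC !horner_algX mulrDr mulrDl.
congr (_ + _); first by rewrite mulrA IHr -[LHS]mulrA au mulrA.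
by rewrite mulr_algl mulr_algr.
Qed.

Let z0 := z_m * z_p.

Let zpz0 : z_p * z0 = z0 * z_p.
Proof. by rewrite /z0 mulrA A_zz. Qed.
Let zmz0 : z_m * z0 = z0 * z_m.
Proof. by rewrite /z0 -[RHS]mulrA A_zz. Qed.
Let xmz0 : x_m * z0 = (q ^+ 2 *: z0) * x_m.
Proof.
by rewrite mulrA A_xmzm -!scalerAl -[_ * _ * z_p]mulrA A_xmzp -scalerAr scalerA
  mulrA.
Qed.
Let xpz0 : x_p * z0 = (q ^- 2 *: z0) * x_p.
Proof.
by rewrite mulrA A_xpzm -!scalerAl -[_ * _ * z_p]mulrA A_xpzp -scalerAr scalerA
  mulrA -expr2 exprVn.
Qed.

Lemma BA_rel s t : B_rel s t -> eval BA_gen s = eval BA_gen t.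
Proof.
case=> {s t}; rewrite /= ?eval_horner /= ?mulr_algl -/z0.
- by rewrite -mulrA zpz0 mulrA xmz0 -mulrA.
- by rewrite -mulrA xpz0 mulrA -scalerAr zmz0 -!scalerAl mulrA.
- rewrite mulrA -[x_m * z_p * z_m]mulrA A_zz -/z0 xmz0 -mulrA A_xmxp.
  by [].
- rewrite mulrA -[z_m * x_p * x_m]mulrA A_xpxm A_zz -/z0.
  by rewrite -mulrA -(horner_alg_twist _ zpz0) mulrA.
Qed.

Definition BA : algB -> algA := palg_lift BA_gen.

HB.instance Definition _ :=
  GRing.isZmodMorphism.Build algB algA BA (palg_lift_zmod BA_rel).
HB.instance Definition _ :=
  GRing.isMonoidMorphism.Build algB algA BA (palg_lift_monoid BA_rel).
HB.instance Definition _ :=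
  GRing.isScalable.Build K algB algA *:%R BA (palg_lift_scalable BA_rel).

Lemma BA_gx : BA (B_val gx) = x_m * z_p.
Proof. exact: palg_lift_gen BA_rel _. Qed.
Lemma BA_gy : BA (B_val gy) = z_m * x_p.
Proof. exact: palg_lift_gen BA_rel _. Qed.
Lemma BA_gz : BA (B_val gz) = z_m * z_p.
Proof. exact: palg_lift_gen BA_rel _. Qed.

Lemma homog_scalar c : c%:A \in homog 0.
Proof.
rewrite homogZ //; have := homog_word [::].
by rewrite /A_word /A_wdeg !big_nil.
Qed.

Lemma homog_gen g : A_val g \in homog (A_deg g).
Proof.
by have := homog_word [:: g]; rewrite /A_word /A_wdeg !big_seq1.
Qed.

Lemma BA_homog b : BA b \in homog 0.
Proof.
elim/cls_ind: b => t; rewrite /BA palg_liftE; last exact: BA_rel.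
elim: t => [c|g|s IHs t IHt|s IHs t IHt] /=.
- exact: homog_scalar.
- by case: g; [have := homogM (homog_gen gxm) (homog_gen gzp)
    | have := homogM (homog_gen gzm) (homog_gen gxp)
    | have := homogM (homog_gen gzm) (homog_gen gzp)].
- exact: homogD.
- by have := homogM IHs IHt; rewrite addr0.
Qed.

Section Component.
Variable k : int.

(* [A_left] is the component as a left B-module; [A_right] is the component as
   a right B-module, i.e. as a left module over the converse ring of B. *)
Definition A_left : Type := A_comp k.
Definition A_right : Type := A_comp k.

HB.instance Definition _ := GRing.Zmodule.on A_left.
HB.instance Definition _ := GRing.Zmodule.on A_right.

Fact lact_homog (b : algB) (a : A_comp k) : BA b * val a \in homog k.
Proof. by have := homogM (BA_homog b) (valP a); rewrite add0r. Qed.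

Fact ract_homog (a : A_comp k) (b : algB) : val a * BA b \in homog k.
Proof. by have := homogM (valP a) (BA_homog b); rewrite addr0. Qed.

Definition lact (b : algB) (a : A_left) : A_left :=
  exist _ (BA b * sval a) (lact_homog b a).
Definition ract (b : algB^c) (a : A_right) : A_right :=
  exist _ (sval a * BA b) (ract_homog a b).

Fact lactA b c a : lact b (lact c a) = lact (b * c) a.
Proof. by apply: val_inj; rewrite /= mulrA rmorphM. Qed.
Fact lact1 : left_id 1 lact.
Proof. by move=> a; apply: val_inj; rewrite /= rmorph1 mul1r. Qed.
Fact lactDr : right_distributive lact +%R.
Proof. by move=> b a a'; apply: val_inj; rewrite /= mulrDr. Qed.
Fact lactDl a : {morph lact^~ a : b c / b + c}.
Proof. by move=> b c; apply: val_inj; rewrite /= rmorphD mulrDl. Qed.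

HB.instance Definition _ :=
  GRing.Zmodule_isLmodule.Build algB A_left lactA lact1 lactDr lactDl.

Fact ractA b c a : ract b (ract c a) = ract (b * c) a.
Proof. by apply: val_inj; rewrite /= -mulrA -rmorphM. Qed.
Fact ract1 : left_id 1 ract.
Proof. by move=> a; apply: val_inj; rewrite /= rmorph1 mulr1. Qed.
Fact ractDr : right_distributive ract +%R.
Proof. by move=> b a a'; apply: val_inj; rewrite /= mulrDl. Qed.
Fact ractDl a : {morph ract^~ a : b c / b + c}.
Proof. by move=> b c; apply: val_inj; rewrite /= rmorphD mulrDr. Qed.

HB.instance Definition _ :=
  GRing.Zmodule_isLmodule.Build algB^c A_right ractA ract1 ractDr ractDl.

End Component.
End AlgebraA.

Section Free.
Variables (R : pzRingType) (M : lmodType R).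

Definition lin_indep (I : eqType) (e : I -> M) : Prop :=
  forall (s : seq I) (c : I -> R),
    uniq s -> \sum_(i <- s) c i *: e i = 0 -> {in s, forall i, c i = 0}.

Definition spanning (I : eqType) (e : I -> M) : Prop :=
  forall v, exists (s : seq I) (c : I -> R), v = \sum_(i <- s) c i *: e i.

Definition free_module : Prop :=
  exists (I : eqType) (e : I -> M), lin_indep e /\ spanning e.

End Free.

(* Main.v *)
Require Import Defs.
From mathcomp Require Import all_boot all_order all_algebra.
From mathcomp Require Import boolp functions ring.

(** Write x+, x-, z+, z- for the generators of A and z for z- z+. Inside A,
    both orders of each of the pairs (x+, x-) and (z+, z-) multiply to a
    polynomial in z. Since p(0) is invertible, p = p(0) + X r, and so
    p(0) = x+ x- - z r(z) = x- x+ - q^2 z r(q^2 z): the unit ideal is reached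
    by products of elements of degree 1 with elements of degree -1, and each
    of A_1, A_(-1) is a direct summand of B^2. The Koszul relation
    x+ z+ - q^-1 z+ x+ = 0 identifies the complement of A_1 with A_(-1).
    Concretely, the matrices
<<
      M = | m11   m12 |          N = | z+   m12 |
          | x+    m22 |              | x+   n22 |
>>
    over A, whose entries have degrees -1, -1 / 1, 1 for M and 1, -1 / 1, -1
    for N, are inverse to each other (lemmas MN11 to NM22). Right
    multiplication of rows by N is then an isomorphism from B^2 to
    A_1 + A_(-1) as left modules, with inverse M, and left multiplication of
    columns by M is an isomorphism from B^2 to A_(-1) + A_1 as right modules,
    with inverse N; this is A_left_free and A_right_free.

    What makes this work is that B really is the degree-zero part of A.
    - Surjectivity (BA_onto): the relations rewrite every word of degree k as
      a combination of f(z) zeta_(k - n) xi_n, where zeta_n and xi_n are the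
      n-th powers of z+ and x+, read as powers of z- and x- for n < 0. In
      degree zero, zeta_(-n) xi_n is a multiple of a power of z- x+ or z+ x-.
    - Injectivity (BA_inj): the relations of B write every element as a sum of
      f_n(z) t_n, where t_n is the n-th power of x, read as a power of y for
      n < 0. A module over A on families of polynomials indexed by the
      integers separates these sums: z multiplies by X and t_n moves the
      family supported at 0 to a nonzero family supported at n. *)

Set Implicit Arguments.
Unset Strict Implicit.
Unset Printing Implicit Defensive.

Import GRing.Theory.
Local Open Scope ring_scope.

(** * Modules over a presented algebra *)

Section PresentedModules.
Variables (K : fieldType) (G : Type) (V : lmodType K) (rho : G -> V -> V).

Fixpoint term_act (t : term K G) (v : V) : V :=
  match t with
  | Sca a => a *: v
  | Gen g => rho g v
  | Add s t => term_act s v + term_act t v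
  | Mul s t => term_act s (term_act t v)
  end.

Hypothesis rho_linear : forall g, linear (rho g).

Lemma term_act_linear t : linear (term_act t).
Proof.
elim: t => [b|g|s IHs t IHt|s IHs t IHt] a u v //=.
- by rewrite scalerDr !scalerA mulrC.
- exact: rho_linear.
- by rewrite IHs IHt scalerDr addrACA.
- by rewrite IHt IHs.
Qed.

Variable rel : term K G -> term K G -> Prop.
Hypothesis rho_rel : forall s t, rel s t -> term_act s =1 term_act t.

(** Linearity of the operators validates distributivity on the right and the
    centrality of the scalars; the other axioms hold for any operators. *)
Lemma term_act_congr s t : congr rel s t -> term_act s =1 term_act t.
Proof.
have actD r u v : term_act r (u + v) = term_act r u + term_act r v.
  by have := term_act_linear r 1 u v; rewrite !scale1r.
have actZ r a u : term_act r (a *: u) = a *: term_act r u.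
  have act0 : term_act r 0 = 0 by apply: (addrI (term_act r 0)); rewrite -actD !addr0.
  by have := term_act_linear r a u 0; rewrite act0 !addr0.
elim=> {s t} /=.
- exact: rho_rel.
- by [].
- by move=> s t _ IH v.
- by move=> s t u _ IH1 _ IH2 v; rewrite IH1.
- by move=> s s' t t' _ IH1 _ IH2 v /=; rewrite IH1 IH2.
- by move=> s s' t t' _ IH1 _ IH2 v /=; rewrite IH2 IH1.
- by move=> s t u v /=; rewrite addrA.
- by move=> s t v /=; rewrite addrC.
- by move=> t v /=; rewrite scale0r add0r.
- by move=> t v /=; rewrite scaleN1r addNr scale0r.
- by [].
- by move=> t v /=; rewrite scale1r.
- by [].
- by move=> s t u v /=; rewrite actD.
- by move=> a b v /=; rewrite scalerDl.
- by move=> a b v /=; rewrite scalerA.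
- by move=> a t v /=; rewrite actZ.
Qed.

Definition palg_act (x : palg rel) : V -> V := term_act (repr x).

Lemma palg_actE t : palg_act (cls rel t) =1 term_act t.
Proof. exact/term_act_congr/repr_cls. Qed.

Lemma palg_act_gen g v : palg_act (cls rel (Gen K g)) v = rho g v.
Proof. exact: palg_actE. Qed.

Lemma palg_actD x y v : palg_act (x + y) v = palg_act x v + palg_act y v.
Proof.
by elim/cls_ind: x => s; elim/cls_ind: y => t; rewrite -clsD !palg_actE.
Qed.

Lemma palg_actM x y v : palg_act (x * y) v = palg_act x (palg_act y v).
Proof.
by elim/cls_ind: x => s; elim/cls_ind: y => t; rewrite -clsM !palg_actE.
Qed.

Lemma palg_actZ a x v : palg_act (a *: x) v = a *: palg_act x v.
Proof. by elim/cls_ind: x => s; rewrite -clsZ !palg_actE. Qed.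

Lemma palg_act0 v : palg_act 0 v = 0.
Proof. by rewrite -(scale0r 0) palg_actZ scale0r. Qed.

Lemma palg_act1 v : palg_act 1 v = v.
Proof. by rewrite -cls1 palg_actE /= scale1r. Qed.

End PresentedModules.

(** * A module detecting the degree-zero part of A *)

Section Representation.
Variables (K : fieldType) (p : {poly K}) (q : K).
Hypothesis q_neq0 : q != 0.

(** In the skew Laurent ring K[z+^{±1}, z][xi^{±1}] with xi z+ = q z+ xi and
    xi z = q^2 z xi, the assignments x- = xi, x+ = p(z) xi^-1, z- = z z+^-1
    satisfy the relations of A. The family F below stands for the sum of the
    F_n(z) xi^n in the quotient of that ring by the left ideal that z+ - 1
    generates. *)
Definition A_rho (g : A_gen) (F : int -> {poly K}) : int -> {poly K} :=
  fun n => match g with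
  | gzp => q ^ (- n) *: F n
  | gzm => q ^ n *: ('X * F n)
  | gxm => F (n - 1) \Po (q ^+ 2 *: 'X)
  | gxp => p * (F (n + 1) \Po (q ^- 2 *: 'X))
  end.

Arguments A_rho : simpl never.

Lemma A_rho_linear g : linear (A_rho g).
Proof.
move=> a F H; apply: funext => n.
case: g; rewrite /A_rho !fctE ?(comp_polyD, comp_polyZ, mulrDr, scalerDr) //.
- by rewrite scalerAr.
- by rewrite !scalerA mulrC.
- by rewrite -!scalerAr !scalerA mulrC.
Qed.

(** Both p-relations have as right-hand side a polynomial in a term that acts
    as multiplication by a fixed polynomial. *)
Lemma term_act_horner u t (r : {poly K}) F n :
    (forall H m, term_act A_rho t H m = u * H m) ->
  term_act A_rho (horner_term r t) F n = (r \Po u) * F n.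
Proof.
move=> tu; rewrite /horner_term -[in RHS](polyseqK r).
elim: (polyseq r) => [|c s IHs] /=.
  by rewrite comp_poly0 mul0r scale0r.
rewrite !fctE tu IHs cons_poly_def comp_poly_MXaddC mulrDl addrC mulrA.
by rewrite [u * _]mulrC mul_polyC.
Qed.

Lemma comp_scaleX a b (f : {poly K}) :
  (f \Po (a *: 'X)) \Po (b *: 'X) = f \Po ((a * b) *: 'X).
Proof. by rewrite -comp_polyA comp_polyZ comp_polyX scalerA. Qed.

Lemma A_rho_rel s t : A_rel p q s t -> term_act A_rho s =1 term_act A_rho t.
Proof.
have q2 : q ^+ 2 != 0 by rewrite expf_neq0.
have zpzm F n : A_rho gzp (A_rho gzm F) n = 'X * F n.
  by rewrite /A_rho scalerA -expfzDr // addNr scale1r.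
have zmzp F n : A_rho gzm (A_rho gzp F) n = 'X * F n.
  by rewrite /A_rho -scalerAr scalerA -expfzDr // subrr scale1r.
case=> {s t} F; apply: funext => n.
- by rewrite /= zpzm zmzp.
- rewrite /= fctE /A_rho comp_polyZ -!scalerAr scalerA -[q^-1]/(q ^ (-1)).
  by rewrite -expfzDr // opprD addrC.
- rewrite /= fctE /A_rho comp_polyZ comp_polyM comp_polyX ['X * (p * _)]mulrCA.
  rewrite -!scalerAl -!scalerAr !scalerA; congr (_ *: _).
  rewrite -[q^-1]/(q ^ (-1)) -[q ^- 2]/(q ^ (-2)) -!expfzDr //.
  by congr (q ^ _); rewrite -addrA addrC.
- rewrite /= fctE /A_rho comp_polyZ scalerA -[q in RHS]/(q ^ 1) -expfzDr //.
  by rewrite opprB.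
- rewrite /= fctE /A_rho comp_polyZ comp_polyM comp_polyX -!scalerAl !scalerA.
  congr (_ *: _); rewrite -[q ^+ 2]/(q ^ 2) -[q in RHS]/(q ^ 1) -!expfzDr //.
  by congr (q ^ _); rewrite -addrA addrC.
- rewrite (@term_act_horner 'X) => [|H m]; last by rewrite /= zpzm.
  by rewrite /= /A_rho comp_scaleX addrK mulfV // scale1r !comp_polyXr.
- rewrite (@term_act_horner (q ^+ 2 *: 'X)) => [|H m] /=.
    by rewrite /A_rho comp_polyM comp_scaleX subrK mulVf // scale1r comp_polyXr.
  by rewrite fctE zmzp scalerAl.
Qed.
End Representation.

(** * Sums of monomials with coefficients polynomial in z *)

Section NormalForms.
Variables (K : fieldType) (R : algType K) (z : R).
Implicit Types (f : {poly K}) (m : int -> R).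

Local Notation "f .(z)" := (horner_alg z f) (at level 2, format "f .(z)").

(** Integer powers of u when v plays the part of an inverse of u. *)
Definition ipow (u v : R) (n : int) : R :=
  match n with Posz k => u ^+ k | Negz k => v ^+ k.+1 end.

Lemma ipowN u v n : ipow u v (- n) = ipow v u n.
Proof. by case: n => [[|k]|k]. Qed.

(** A generator shifts the exponent by one, at the price of a polynomial in z
    when it meets its partner. *)
Lemma mul_ipow_succ u v e n :
  u * v = e.(z) -> exists f, u * ipow u v n = f.(z) * ipow u v (n + 1).
Proof.
move=> uv; case: n => k.
  by exists 1; rewrite rmorph1 mul1r -PoszD addn1 /= -exprS.
exists e; rewrite /= exprS mulrA uv; congr (_ * _).
by rewrite NegzE -addn1 PoszD opprD subrK ipowN.
Qed.

Lemma mul_ipow_pred u v e n :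
  v * u = e.(z) -> exists f, v * ipow u v n = f.(z) * ipow u v (n - 1).
Proof.
move=> vu; have [f fE] := mul_ipow_succ (- n) vu; exists f.
by rewrite -ipowN fE -ipowN opprD opprK.
Qed.

Lemma qcomm_exp (g w : R) c k : g * w = c *: (w * g) ->
  g * w ^+ k = c ^+ k *: (w ^+ k * g).
Proof.
move=> gw; elim: k => [|k IHk]; first by rewrite !expr0 mulr1 mul1r scale1r.
rewrite exprS mulrA gw -scalerAl -[w * g * _]mulrA IHk -scalerAr scalerA mulrA.
by rewrite -!exprS.
Qed.

Lemma qcomm_ipow (g u v : R) a b n : g * u = a *: (u * g) -> g * v = b *: (v * g) ->
  exists c, g * ipow u v n = c *: (ipow u v n * g).
Proof.
by move=> gu gv; case: n => k; eexists; apply: qcomm_exp; eassumption.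
Qed.

Lemma horner_alg_scale c f : (f \Po (c *: 'X)).(z) = horner_alg (c *: z) f.
Proof.
elim/poly_ind: f => [|f d IHf]; first by rewrite comp_poly0 !rmorph0.
rewrite comp_poly_MXaddC !rmorphD !rmorphM /= IHf linearZ /=.
by rewrite !horner_algC !horner_algX mulr_algl.
Qed.

Lemma qcomm_horner g c f :
  g * z = c *: (z * g) -> g * f.(z) = (f \Po (c *: 'X)).(z) * g.
Proof.
move=> gz; rewrite horner_alg_scale.
elim/poly_ind: f => [|f d IHf]; first by rewrite !rmorph0 mulr0 mul0r.
rewrite !rmorphD !rmorphM /= !horner_algC !horner_algX mulrDr mulrDl.
congr (_ + _); last by rewrite mulr_algl mulr_algr.
by rewrite mulrA IHf -!mulrA gz scalerAl.
Qed.

(** The left K[z]-submodule spanned by the family m. *)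
Definition poly_span m (a : R) : Prop :=
  exists l : seq ({poly K} * int), a = \sum_(t <- l) t.1.(z) * m t.2.

Lemma poly_span0 m : poly_span m 0.
Proof. by exists [::]; rewrite big_nil. Qed.

Lemma poly_span_mon m f n : poly_span m (f.(z) * m n).
Proof. by exists [:: (f, n)]; rewrite big_seq1. Qed.

Lemma poly_spanD m a b : poly_span m a -> poly_span m b -> poly_span m (a + b).
Proof. by move=> [l ->] [l' ->]; exists (l ++ l'); rewrite big_cat. Qed.

Lemma poly_span_mull g m m' a :
    (forall f n, poly_span m' (g * (f.(z) * m n))) ->
  poly_span m a -> poly_span m' (g * a).
Proof.
move=> gm [l ->]; rewrite mulr_sumr; elim: l => [|[f n] l IHl].
  by rewrite big_nil; apply: poly_span0.
by rewrite big_cons; apply: poly_spanD.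
Qed.

Lemma poly_spanZ m c a : poly_span m a -> poly_span m (c *: a).
Proof.
rewrite -mulr_algl; apply: poly_span_mull => f n.
by rewrite -(horner_algC z) mulrA -rmorphM; apply: poly_span_mon.
Qed.

Lemma poly_span_uniq m a : poly_span m a ->
  exists (s : seq int) (f : int -> {poly K}),
    uniq s /\ a = \sum_(n <- s) (f n).(z) * m n.
Proof.
move=> [l ->]; exists (undup (map snd l)).
exists (fun n => \sum_(t <- l | t.2 == n) t.1); split; first exact: undup_uniq.
under [RHS]eq_bigr do rewrite rmorph_sum mulr_suml.
rewrite (exchange_big_dep xpredT) //= [LHS]big_seq [RHS]big_seq.
apply: eq_bigr => t tl.
under eq_bigl do rewrite eq_sym.
rewrite -big_filter filter_pred1_uniq ?undup_uniq ?big_seq1 //.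
by rewrite mem_undup; apply: map_f.
Qed.

End NormalForms.

(** * Degree zero of A is the image of B *)

Section BandA.
Variables (K : fieldType) (p : {poly K}) (q : K).
Hypothesis q_neq0 : q != 0.

Local Notation A := (algA p q).
Local Notation B := (algB p q).
Local Notation x_p := (A_val p q gxp).
Local Notation x_m := (A_val p q gxm).
Local Notation z_p := (A_val p q gzp).
Local Notation z_m := (A_val p q gzm).
Local Notation z0 := (z_m * z_p).
Local Notation bx := (B_val p q gx).
Local Notation by_ := (B_val p q gy).
Local Notation bz := (B_val p q gz).

(** The factor 1 makes this an instance of the q-commutation that
    [qcomm_horner] asks for. *)
Lemma zp_z0 : z_p * z0 = 1 *: (z0 * z_p).
Proof. by rewrite scale1r mulrA A_zz. Qed.

Lemma zm_z0 : z_m * z0 = 1 *: (z0 * z_m).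
Proof. by rewrite scale1r -[RHS]mulrA A_zz. Qed.

Lemma xm_z0 : x_m * z0 = q ^+ 2 *: (z0 * x_m).
Proof.
by rewrite mulrA A_xmzm -scalerAl -[z_m * x_m * _]mulrA A_xmzp -scalerAr scalerA mulrA.
Qed.

Lemma xp_z0 : x_p * z0 = q ^- 2 *: (z0 * x_p).
Proof.
rewrite mulrA A_xpzm -scalerAl -[z_m * x_p * _]mulrA A_xpzp -scalerAr scalerA mulrA.
by rewrite -expr2 exprVn.
Qed.

Lemma xp_xm : x_p * x_m = horner_alg z0 p.
Proof. by rewrite A_xpxm A_zz. Qed.

Lemma xm_xp : x_m * x_p = horner_alg z0 (p \Po (q ^+ 2 *: 'X)).
Proof. by rewrite A_xmxp horner_alg_scale. Qed.

Lemma zp_zm : z_p * z_m = horner_alg z0 'X.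
Proof. by rewrite horner_algX A_zz. Qed.

Definition zetaA : int -> A := ipow z_p z_m.
Definition xiA : int -> A := ipow x_p x_m.
Definition A_mon (k n : int) : A := zetaA (k - n) * xiA n.

Lemma zetaA_horner n f : zetaA n * horner_alg z0 f = horner_alg z0 f * zetaA n.
Proof.
have comm_z w : w * z0 = 1 *: (z0 * w) -> GRing.comm w (horner_alg z0 f).
  by move=> wz; rewrite /GRing.comm (qcomm_horner _ wz) scale1r comp_polyXr.
by case: n => k; apply/commr_sym/commrX/commr_sym/comm_z;
  [exact: zp_z0 | exact: zm_z0].
Qed.

(** Every generator sends a monomial to a single monomial: it q-commutes with z
    and with the other pair, and shifts the exponent of its own pair. *)
Lemma gen_A_span g k a :
  poly_span z0 (A_mon k) a -> poly_span z0 (A_mon (A_deg g + k)) (A_val p q g * a).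
Proof.
apply: poly_span_mull => f n.
suff {f} mon : exists e, exists2 m,
    A_val p q g * A_mon k n = horner_alg z0 e * A_mon (A_deg g + k) m &
    exists c, A_val p q g * z0 = c *: (z0 * A_val p q g).
  have [e [m gm [c gz]]] := mon.
  rewrite mulrA (qcomm_horner f gz) -mulrA gm mulrA -rmorphM.
  exact: poly_span_mon.
rewrite /A_mon; case: g => /=.
- have [c cE] := qcomm_ipow (k - n) (A_xpzp p q) (A_xpzm p q).
  have [e eE] := mul_ipow_succ n xp_xm.
  exists (c *: e), (n + 1); last by exists (q ^- 2); apply: xp_z0.
  rewrite mulrA cE -scalerAl -mulrA eE mulrA zetaA_horner -mulrA scalerAl.
  rewrite linearZ /= mulr_algl; congr (_ * (zetaA _ * _)).
  by rewrite [n + 1]addrC opprD addrACA subrr add0r.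
- have [c cE] := qcomm_ipow (k - n) (A_xmzp p q) (A_xmzm p q).
  have [e eE] := mul_ipow_pred n xm_xp.
  exists (c *: e), (n - 1); last by exists (q ^+ 2); apply: xm_z0.
  rewrite mulrA cE -scalerAl -mulrA eE mulrA zetaA_horner -mulrA scalerAl.
  rewrite linearZ /= mulr_algl; congr (_ * (zetaA _ * _)).
  by rewrite opprB addrACA addNr add0r.
- have [e eE] := mul_ipow_succ (k - n) zp_zm.
  exists e, n; last by exists 1; apply: zp_z0.
  rewrite mulrA eE -mulrA; congr (_ * (zetaA _ * _)).
  by rewrite addrAC [k + 1]addrC.
- have [e eE] := mul_ipow_pred (k - n) (esym (horner_algX z0)).
  exists e, n; last by exists 1; apply: zm_z0.
  rewrite mulrA eE -mulrA; congr (_ * (zetaA _ * _)).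
  by rewrite addrAC [k - 1]addrC.
Qed.

Lemma homog_span k a : a \in homog k -> poly_span z0 (A_mon k) a.
Proof.
have word_span w : poly_span z0 (A_mon (A_wdeg w)) (A_word p q w).
  elim: w => [|g w IHw].
    exists [:: (1, 0)].
    by rewrite big_seq1 /A_word /A_wdeg !big_nil rmorph1 /A_mon subrr !mul1r.
  by rewrite /A_word /A_wdeg !big_cons; apply: gen_A_span.
move=> /homogP[s [/allP sk ->]]; rewrite big_seq.
elim/big_ind: _ => [|a' b|[c w] /sk/eqP /= wk]; first exact: poly_span0.
  exact: poly_spanD.
by apply: poly_spanZ; rewrite -wk.
Qed.

Definition BA_im (a : A) : Prop := exists b : B, a = BA b.

Lemma BA_imM a b : BA_im a -> BA_im b -> BA_im (a * b).
Proof. by move=> [a' ->] [b' ->]; exists (a' * b'); rewrite rmorphM. Qed.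

Lemma BA_imZ c a : BA_im a -> BA_im (c *: a).
Proof. by move=> [a' ->]; exists (c *: a'); rewrite linearZ. Qed.

(** q-commutation turns v^k u^k into a multiple of (v u)^k. *)
Lemma BA_im_pow u v c k : v * u = c *: (u * v) -> BA_im (v * u) ->
  BA_im (v ^+ k * u ^+ k).
Proof.
move=> vu im_vu; elim: k => [|k IHk].
  by exists 1; rewrite !expr0 rmorph1 mulr1.
rewrite exprSr -mulrA exprSr [v * _]mulrA (qcomm_exp k vu) -scalerAl -scalerAr.
by rewrite -(mulrA (u ^+ k)) (mulrA (v ^+ k)); apply/BA_imZ/BA_imM.
Qed.

Lemma BA_horner f : BA (horner_alg bz f : B) = horner_alg z0 f.
Proof.
elim/poly_ind: f => [|f d IHf]; first by rewrite !rmorph0.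
rewrite !rmorphD !rmorphM /= IHf !horner_algC !horner_algX.
by rewrite rmorph_alg BA_gz.
Qed.

Lemma A_mon0_im n : BA_im (A_mon 0 n).
Proof.
have qi (w u : A) (c : K) : c != 0 -> w * u = c *: (u * w) -> u * w = c^-1 *: (w * u).
  by move=> c0 ->; rewrite scalerA mulVf ?scale1r.
have qV0 : q^-1 != 0 by rewrite invr_eq0.
rewrite /A_mon sub0r /zetaA ipowN /xiA; case: n => k /=.
  apply: (BA_im_pow _ (qi _ _ _ qV0 (A_xpzm p q))).
  by exists by_; rewrite BA_gy.
apply: (BA_im_pow _ (qi _ _ _ q_neq0 (A_xmzp p q))).
by rewrite (qi _ _ _ q_neq0 (A_xmzp p q)) -BA_gx; apply: BA_imZ; exists bx.
Qed.

Lemma BA_onto a : a \in homog 0 -> BA_im a.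
Proof.
move=> /homog_span[l ->]; elim/big_ind: _ => [|a' b [a'' ->] [b' ->]|[f n] _].
- by exists 0; rewrite rmorph0.
- by exists (a'' + b'); rewrite rmorphD.
- apply: BA_imM (A_mon0_im n); exists (horner_alg bz f).
  by rewrite BA_horner.
Qed.

(** * The map from B to A is injective *)

Lemma eval_B t : cls (B_rel p q) t = eval (B_val p q : B_gen -> B) t.
Proof.
apply: (eval_unique (i := cls (B_rel p q) : term K B_gen -> B)) => //.
- exact: cls_Sca.
- exact: clsD.
- exact: clsM.
Qed.

Lemma eval_B_rel s t : B_rel p q s t ->
  eval (B_val p q : B_gen -> B) s = eval (B_val p q : B_gen -> B) t.
Proof. by rewrite -!eval_B => st; apply/clsP/congr_rel. Qed.

Lemma B_xz : bx * bz = q ^+ 2 *: (bz * bx).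
Proof. by have /= -> := eval_B_rel (B_rel_xz p q); rewrite mulr_algl scalerAl. Qed.

Lemma B_yz : by_ * bz = q ^- 2 *: (bz * by_).
Proof. by have /= -> := eval_B_rel (B_rel_yz p q); rewrite mulr_algl scalerAl. Qed.

Lemma B_xy : bx * by_ = horner_alg bz (('X * p) \Po (q ^+ 2 *: 'X)).
Proof.
have /= -> := eval_B_rel (B_rel_xy p q).
by rewrite eval_horner /= !mulr_algl horner_alg_scale rmorphM /= horner_algX.
Qed.

Lemma B_yx : by_ * bx = horner_alg bz ('X * p).
Proof.
have /= -> := eval_B_rel (B_rel_yx p q).
by rewrite eval_horner /= rmorphM /= horner_algX.
Qed.

Definition B_mon : int -> B := ipow bx by_.

Lemma gen_B_span g b :
  poly_span bz B_mon b -> poly_span bz B_mon (B_val p q g * b).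
Proof.
apply: poly_span_mull => f n; case: g.
- have [e eE] := mul_ipow_succ n B_xy.
  rewrite mulrA (qcomm_horner f B_xz) -mulrA eE mulrA -rmorphM.
  exact: poly_span_mon.
- have [e eE] := mul_ipow_pred n B_yx.
  rewrite mulrA (qcomm_horner f B_yz) -mulrA eE mulrA -rmorphM.
  exact: poly_span_mon.
- have -> : bz * (horner_alg bz f * B_mon n) = horner_alg bz ('X * f) * B_mon n.
    by rewrite rmorphM /= horner_algX mulrA.
  exact: poly_span_mon.
Qed.

Lemma B_span b : poly_span bz B_mon b.
Proof.
rewrite -[b]mulr1.
have : poly_span bz B_mon 1 by exists [:: (1, 0)]; rewrite big_seq1 rmorph1 mul1r.
elim/cls_ind: b (1 : B) => t.
elim: t => [c|g|s IHs t IHt|s IHs t IHt] b bs.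
- by rewrite cls_Sca mulr_algl; apply: poly_spanZ.
- exact: gen_B_span.
- by rewrite clsD mulrDl; apply: poly_spanD; [apply: IHs | apply: IHt].
- by rewrite clsM -mulrA; apply/IHs/IHt.
Qed.

Definition A_act : A -> (int -> {poly K}) -> int -> {poly K} :=
  palg_act (A_rho p q) (rel := A_rel p q).

Hypothesis p_neq0 : p != 0.

Lemma A_actM a b F : A_act (a * b) F = A_act a (A_act b F).
Proof. exact (palg_actM (A_rho_linear p q) (@A_rho_rel _ p _ q_neq0) a b F). Qed.

Lemma A_actD a b F : A_act (a + b) F = A_act a F + A_act b F.
Proof. exact (palg_actD (A_rho_linear p q) (@A_rho_rel _ p _ q_neq0) a b F). Qed.

Lemma A_actZ c a F : A_act (c *: a) F = c *: A_act a F.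
Proof. exact (palg_actZ (A_rho_linear p q) (@A_rho_rel _ p _ q_neq0) c a F). Qed.

Lemma A_act1 F : A_act 1 F = F.
Proof. exact (palg_act1 (A_rho_linear p q) (@A_rho_rel _ p _ q_neq0) F). Qed.

Lemma A_act0 F : A_act 0 F = 0.
Proof. exact (palg_act0 (A_rho_linear p q) (@A_rho_rel _ p _ q_neq0) F). Qed.

Lemma A_act_gen g F : A_act (A_val p q g) F = A_rho p q g F.
Proof. exact (palg_act_gen (A_rho_linear p q) (@A_rho_rel _ p _ q_neq0) g F). Qed.

Lemma A_act_horner f F n : A_act (horner_alg z0 f) F n = f * F n.
Proof.
elim/poly_ind: f F n => [|f d IHf] F n.
  by rewrite rmorph0 A_act0 mul0r.
rewrite rmorphD rmorphM /= horner_algC horner_algX A_actD A_actZ !A_actM A_act1.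
rewrite !fctE IHf mulrDl mul_polyC -mulrA; congr (_ * _ + _).
by rewrite !A_act_gen /A_rho -scalerAr scalerA -expfzDr // subrr scale1r.
Qed.

Definition single (n : int) (c : {poly K}) : int -> {poly K} :=
  fun i => if i == n then c else 0.

Lemma comp_scaleX_neq0 c (f : {poly K}) :
  c != 0 -> f != 0 -> f \Po (c *: 'X) != 0.
Proof.
by move=> c0 f0; rewrite comp_poly2_eq0 // size_scale // size_polyX.
Qed.

(** x moves the support by 1 and y by -1; the coefficients stay nonzero because
    a substitution X -> c X with c != 0 and multiplication by X p preserve
    nonzero polynomials. *)
Lemma A_act_Bmon n : exists2 c, c != 0 &
  A_act (BA (B_mon n)) (single 0 1) = single n c.
Proof.
have qn0 i : q ^ i != 0 by rewrite expfz_neq0.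
have q2 : q ^+ 2 != 0 by rewrite expf_neq0.
rewrite /B_mon; case: n => k /=.
  elim: k => [|k [c c0 IHk]].
    by exists 1; rewrite ?oner_neq0 // rmorph1 A_act1.
  exists ((q ^ (- k%:Z) *: c) \Po (q ^+ 2 *: 'X)).
    by rewrite comp_scaleX_neq0 // scaler_eq0 negb_or qn0.
  rewrite exprS rmorphM /= A_actM IHk BA_gx A_actM !A_act_gen.
  apply: funext => i; rewrite /A_rho /single subr_eq -PoszD addn1.
  case: eqP => [->|_]; last by rewrite scaler0 comp_poly0.
  by rewrite intS [1 + _]addrC addrK.
rewrite NegzE; elim: (k.+1) => [|j [c c0 IHj]].
  by exists 1; rewrite ?oner_neq0 // rmorph1 A_act1.
exists (q ^ (- j.+1%:Z) *: ('X * (p * (c \Po (q ^- 2 *: 'X))))).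
  rewrite scaler_eq0 negb_or qn0 !mulf_neq0 ?polyX_eq0 //.
  by rewrite comp_scaleX_neq0 // invr_eq0.
rewrite exprS rmorphM /= A_actM IHj BA_gy A_actM !A_act_gen.
apply: funext => i; rewrite /A_rho /single.
(* i + 1 == - j is restated as i == - (j + 1) *)
rewrite -[1]opprK subr_eq intS opprD addrC [- 1 - _]addrC.
by case: eqP => [->|_] //; rewrite comp_poly0 !mulr0 scaler0.
Qed.

(** Acting on the family supported at 0 with value 1, the coordinate n of the
    result isolates the coefficient of the n-th monomial. *)
Lemma BA_inj (b : B) : BA b = 0 -> b = 0.
Proof.
have [s [f [s_uniq ->]]] := poly_span_uniq (B_span b) => BAb0.
rewrite big_seq big1 // => n ns.
suff -> : f n = 0 by rewrite rmorph0 mul0r.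
have [c c0 cE] := A_act_Bmon n.
have A_act_sum l F : A_act (\sum_(i <- l) BA (horner_alg bz (f i) * B_mon i)) F =
    \sum_(i <- l) A_act (BA (horner_alg bz (f i) * B_mon i)) F.
  by apply: (big_morph (A_act^~ F)) => [a a'|]; rewrite ?A_actD ?A_act0.
have /(congr1 (fun a => A_act a (single 0 1) n)) := BAb0.
rewrite raddf_sum A_act_sum A_act0 fct_sumE (bigD1_seq n) //= big1 => [|i ni].
  rewrite addr0 rmorphM /= BA_horner A_actM A_act_horner cE /single eqxx.
  by move/eqP; rewrite mulf_eq0 (negPf c0) orbF => /eqP.
have [d _ dE] := A_act_Bmon i.
rewrite rmorphM /= BA_horner A_actM A_act_horner dE /single.
by rewrite eq_sym (negPf ni) mulr0.
Qed.

End BandA.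

(** * The two inverse matrices *)

Section InverseMatrices.
Variables (K : fieldType) (p : {poly K}) (q : K).
Hypotheses (q_neq0 : q != 0) (p0_neq0 : p.[0] != 0).

Local Notation A := (algA p q).
Local Notation x_p := (A_val p q gxp).
Local Notation x_m := (A_val p q gxm).
Local Notation z_p := (A_val p q gzp).
Local Notation z_m := (A_val p q gzm).
Local Notation z0 := (z_m * z_p).
Local Notation "f .(z)" := (horner_alg z0 f) (at level 2, format "f .(z)").

Definition divX : {poly K} := (p - p.[0]%:P) %/ 'X.

Local Notation r := divX.
Local Notation rq := (divX \Po (q ^+ 2 *: 'X)).

Lemma divXE : p = 'X * r + p.[0]%:P.
Proof.
rewrite mulrC divpK ?subrK // -['X]subr0 -polyC0 dvdp_XsubCl.
by rewrite rootE !hornerE subrr.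
Qed.

Lemma zp_horner f : z_p * f.(z) = f.(z) * z_p.
Proof. by rewrite (qcomm_horner f (zp_z0 p q)) scale1r comp_polyXr. Qed.

Lemma zm_horner f : z_m * f.(z) = f.(z) * z_m.
Proof. by rewrite (qcomm_horner f (zm_z0 p q)) scale1r comp_polyXr. Qed.

Lemma xp_rq : x_p * rq.(z) = r.(z) * x_p.
Proof.
rewrite (qcomm_horner _ (xp_z0 p q)) comp_scaleX divff ?expf_neq0 //.
by rewrite scale1r comp_polyXr.
Qed.

Lemma xm_r : x_m * r.(z) = rq.(z) * x_m.
Proof. exact/qcomm_horner/xm_z0. Qed.

Lemma hornerA_p : p.(z) = p.[0] *: 1 + r.(z) * z0.
Proof.
transitivity ('X * r + p.[0]%:P).(z); first by rewrite -divXE.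
rewrite rmorphD rmorphM /= horner_algC horner_algX addrC.
by congr (_ + _); rewrite -mulrA zp_horner mulrA zm_horner mulrA.
Qed.

Lemma hornerA_pq : (p \Po (q ^+ 2 *: 'X)).(z) = p.[0] *: 1 + q ^+ 2 *: (rq.(z) * z0).
Proof.
transitivity (('X * r + p.[0]%:P) \Po (q ^+ 2 *: 'X)).(z); first by rewrite -divXE.
rewrite comp_polyD comp_polyM comp_polyX comp_polyC.
rewrite -scalerAl -[q ^+ 2 *: ('X * _)]mul_polyC rmorphD rmorphM /= !horner_algC.
rewrite mulr_algl rmorphM /= horner_algX addrC; congr (_ + _ *: _).
by rewrite -mulrA zp_horner mulrA zm_horner mulrA.
Qed.

(** m11 and m12 solve m11 z+ + m12 x+ = 1, from the expansion of x- x+; with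
    m22 fixed by the Koszul relation, n22 solves x+ m12 + m22 n22 = 1, from
    the expansion of x+ x-. The remaining identities follow from these two and
    from the q-commutation rules. *)
Definition m11 : A := - (q ^+ 2 / p.[0]) *: (rq.(z) * z_m).
Definition m12 : A := p.[0]^-1 *: x_m.
Definition m22 : A := - q^-1 *: z_p.
Definition n22 : A := (q / p.[0]) *: (z_m * r.(z)).

Lemma m22_mul a : m22 * a = - (q^-1 *: (z_p * a)).
Proof. by rewrite -scalerAl scaleNr. Qed.

Lemma mul_m22 a : a * m22 = - (q^-1 *: (a * z_p)).
Proof. by rewrite -scalerAr scaleNr. Qed.

Lemma MN11 : m11 * z_p + m12 * x_p = 1.
Proof.
rewrite /m11 /m12 -!scalerAl xm_xp hornerA_pq -[_ * z_m * z_p]mulrA scalerDr !scalerA mulVf //.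
by rewrite scale1r [q ^+ 2 / _]mulrC scaleNr addrCA addNr addr0.
Qed.

Lemma MN12 : m11 * m12 + m12 * n22 = 0.
Proof.
rewrite /m11 /m12 /n22 -!scalerAl -!scalerAr !scalerA (mulrA x_m) A_xmzm -scalerAl.
rewrite -(mulrA z_m) xm_r (mulrA z_m) zm_horner scalerA -scalerDl mulNr.
suff -> : p.[0]^-1 * (q / p.[0]) * q = q ^+ 2 / p.[0] / p.[0].
  by rewrite addNr scale0r.
by ring.
Qed.

Lemma MN21 : x_p * z_p + m22 * x_p = 0.
Proof. by rewrite m22_mul A_xpzp subrr. Qed.

Lemma MN22 : x_p * m12 + m22 * n22 = 1.
Proof.
rewrite m22_mul /m12 /n22 -!scalerAr xp_xm hornerA_p scalerDr !scalerA mulKf //.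
rewrite mulVf // scale1r (mulrA z_p) A_zz -(mulrA z_m) zp_horner.
by rewrite (mulrA z_m) zm_horner -(mulrA r.(z)) addrK.
Qed.

Lemma NM11 : z_p * m11 + m12 * x_p = 1.
Proof.
rewrite -[RHS]MN11; congr (_ + _); rewrite /m11 -scalerAl -scalerAr.
by rewrite mulrA zp_horner -!mulrA A_zz.
Qed.

Lemma NM12 : z_p * m12 + m12 * m22 = 0.
Proof.
rewrite mul_m22; apply/eqP; rewrite subr_eq0; apply/eqP.
by rewrite /m12 -scalerAl -scalerAr A_xmzp !scalerA mulrAC mulVf // mul1r.
Qed.

Lemma NM21 : x_p * m11 + n22 * x_p = 0.
Proof.
rewrite /m11 /n22 -scalerAr -scalerAl mulrA xp_rq -(mulrA r.(z)) A_xpzm -scalerAr.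
rewrite zm_horner !mulrA scalerA -scalerDl mulNr [- _ + _]addrC.
suff -> : q ^+ 2 / p.[0] / q = q / p.[0] by rewrite subrr scale0r.
by rewrite mulrAC expr2 mulfK.
Qed.

Lemma NM22 : x_p * m12 + n22 * m22 = 1.
Proof.
rewrite -[RHS]MN22 m22_mul mul_m22; congr (_ - _ *: _); rewrite /n22 -scalerAl -scalerAr.
by rewrite -mulrA -zp_horner mulrA -A_zz -mulrA.
Qed.

End InverseMatrices.

Section Homogeneity.
Variables (K : fieldType) (p : {poly K}) (q : K).

Lemma horner_homog (f : {poly K}) :
  horner_alg (A_val p q gzm * A_val p q gzp) f \in homog 0.
Proof. by rewrite -BA_horner; apply: BA_homog. Qed.

Lemma m11_homog : m11 p q \in homog (-1).
Proof.
apply: homogZ; rewrite -[-1]add0r.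
exact: homogM (horner_homog _) (homog_gen p q gzm).
Qed.

Lemma m12_homog : m12 p q \in homog (-1).
Proof. exact/homogZ/(homog_gen p q gxm). Qed.

Lemma n22_homog : n22 p q \in homog (-1).
Proof.
apply: homogZ; rewrite -[-1]addr0.
exact: homogM (homog_gen p q gzm) (horner_homog _).
Qed.

End Homogeneity.

(** * Freeness from inverse matrices of homogeneous elements *)

Section FreeOnTwo.
Variables (R : pzRingType) (M : lmodType R) (e1 e2 : M).

Lemma free_module2 :
    (forall c1 c2, c1 *: e1 + c2 *: e2 = 0 -> c1 = 0 /\ c2 = 0) ->
    (forall v, exists c1 c2, v = c1 *: e1 + c2 *: e2) ->
  free_module M.
Proof.
move=> e_indep e_span; exists bool, (fun i : bool => if i then e1 else e2).
split=> [s c s_uniq sum0|v]; last first.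
  have [c1 [c2 ->]] := e_span v.
  exists [:: true; false], (fun i : bool => if i then c1 else c2).
  by rewrite big_cons big_seq1.
have /e_indep[c1 c2] : (if true \in s then c true else 0) *: e1 +
    (if false \in s then c false else 0) *: e2 = 0.
  rewrite -[RHS]sum0 big_uniq //= big_mkcond /= big_bool /=.
  by congr (_ + _); case: ifP => // _; rewrite scale0r.
by case=> is_in; [move: c1 | move: c2]; rewrite is_in.
Qed.

End FreeOnTwo.

Lemma row2_assoc (R : pzRingType) (a b u1 u2 v1 v2 z1 z2 : R) :
  (a * u1 + b * v1) * z1 + (a * u2 + b * v2) * z2 =
  a * (u1 * z1 + u2 * z2) + b * (v1 * z1 + v2 * z2).
Proof. by rewrite !mulrDl !mulrDr !mulrA addrACA. Qed.

Lemma col2_assoc (R : pzRingType) (a b u1 u2 v1 v2 z w : R) :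
  z * (u1 * a + u2 * b) + w * (v1 * a + v2 * b) =
  (z * u1 + w * v1) * a + (z * u2 + w * v2) * b.
Proof. by rewrite !mulrDl !mulrDr !mulrA addrACA. Qed.

(** M has rows (u1, u2) and (v1, v2), N has rows (z1, w1) and (z2, w2). The rows
    of N form a basis of the left module, the columns of M one of the right
    module, and the coordinates of an element are read off with the inverse
    matrix; they have degree zero, so they come from B. *)
Section GradedInverses.
Variables (K : fieldType) (p : {poly K}) (q : K).
Hypotheses (q_neq0 : q != 0) (p_neq0 : p != 0).

Local Notation A := (algA p q).
Local Notation B := (algB p q).

Variables z1 z2 v1 v2 w1 w2 u1 u2 : A.
Hypotheses (z1P : z1 \in homog 1) (z2P : z2 \in homog 1).
Hypotheses (v1P : v1 \in homog 1) (v2P : v2 \in homog 1).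
Hypotheses (w1P : w1 \in homog (-1)) (w2P : w2 \in homog (-1)).
Hypotheses (u1P : u1 \in homog (-1)) (u2P : u2 \in homog (-1)).

Hypotheses (MN11 : u1 * z1 + u2 * z2 = 1) (MN12 : u1 * w1 + u2 * w2 = 0).
Hypotheses (MN21 : v1 * z1 + v2 * z2 = 0) (MN22 : v1 * w1 + v2 * w2 = 1).
Hypotheses (NM11 : z1 * u1 + w1 * v1 = 1) (NM12 : z1 * u2 + w1 * v2 = 0).
Hypotheses (NM21 : z2 * u1 + w2 * v1 = 0) (NM22 : z2 * u2 + w2 * v2 = 1).

Let BAlift (k : int) (a b a' b' : A) :
    a \in homog k -> b \in homog (- k) -> a' \in homog (- k) -> b' \in homog k ->
  exists c : B, BA c = a * b + a' * b'.
Proof.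
move=> ak bk a'k b'k; have [|c ->] := @BA_onto _ p q q_neq0 (a * b + a' * b').
  by apply: homogD; [rewrite -(subrr k) | rewrite -(addNr k)]; apply: homogM.
by exists c.
Qed.

Lemma A_left_free :
  free_module (A_left p q 1 * A_left p q (-1) : lmodType B)%type.
Proof.
pose e1 : A_left p q 1 * A_left p q (-1) :=
  (exist (fun a => a \in homog 1) z1 z1P, exist (fun a => a \in homog (-1)) w1 w1P).
pose e2 : A_left p q 1 * A_left p q (-1) :=
  (exist (fun a => a \in homog 1) z2 z2P, exist (fun a => a \in homog (-1)) w2 w2P).
apply: (@free_module2 _ _ e1 e2) => [c1 c2 ce0|[[a aP] [b bP]]].
  have cz0 : BA c1 * z1 + BA c2 * z2 = 0 := congr1 (fun t => sval t.1) ce0.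
  have cw0 : BA c1 * w1 + BA c2 * w2 = 0 := congr1 (fun t => sval t.2) ce0.
  split; apply: (BA_inj q_neq0 p_neq0).
    have := row2_assoc (BA c1) (BA c2) z1 w1 z2 w2 u1 v1.
    by rewrite cz0 cw0 NM11 NM21 !mul0r addr0 mulr1 mulr0 addr0 => <-.
  have := row2_assoc (BA c1) (BA c2) z1 w1 z2 w2 u2 v2.
  by rewrite cz0 cw0 NM12 NM22 !mul0r addr0 mulr1 mulr0 add0r => <-.
have [c1 c1E] := BAlift aP u1P bP v1P.
have [c2 c2E] := BAlift aP u2P bP v2P.
exists c1, c2; congr pair; apply: val_inj; rewrite /= c1E c2E row2_assoc.
  by rewrite MN11 MN21 mulr1 mulr0 addr0.
by rewrite MN12 MN22 mulr1 mulr0 add0r.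
Qed.

Lemma A_right_free :
  free_module (A_right p q 1 * A_right p q (-1) : lmodType B^c)%type.
Proof.
pose e1 : A_right p q 1 * A_right p q (-1) :=
  (exist (fun a => a \in homog 1) v1 v1P, exist (fun a => a \in homog (-1)) u1 u1P).
pose e2 : A_right p q 1 * A_right p q (-1) :=
  (exist (fun a => a \in homog 1) v2 v2P, exist (fun a => a \in homog (-1)) u2 u2P).
apply: (@free_module2 _ _ e1 e2) => [c1 c2 ce0|[[a aP] [b bP]]].
  have vc0 : v1 * BA c1 + v2 * BA c2 = 0 := congr1 (fun t => sval t.1) ce0.
  have uc0 : u1 * BA c1 + u2 * BA c2 = 0 := congr1 (fun t => sval t.2) ce0.
  split; apply: (BA_inj q_neq0 p_neq0).
    have := col2_assoc (BA c1) (BA c2) u1 u2 v1 v2 z1 w1.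
    by rewrite vc0 uc0 NM11 NM12 !mulr0 addr0 mul1r mul0r addr0 => <-.
  have := col2_assoc (BA c1) (BA c2) u1 u2 v1 v2 z2 w2.
  by rewrite vc0 uc0 NM21 NM22 !mulr0 addr0 mul1r mul0r add0r => <-.
have [c1 c1E] := BAlift z1P bP w1P aP.
have [c2 c2E] := BAlift z2P bP w2P aP.
exists c1, c2; congr pair; apply: val_inj; rewrite /= c1E c2E.
  by rewrite col2_assoc MN21 MN22 mul0r mul1r add0r.
by rewrite col2_assoc MN11 MN12 mul0r mul1r addr0.
Qed.

End GradedInverses.

Theorem lemma5p2 (K : fieldType) (q : K) (p : {poly K})
    (charK0 : [pchar K] =i pred0) (q_neq0 : q != 0) (p0_neq0 : p.[0] != 0) :
  free_module (A_left p q 1 * A_left p q (-1) : lmodType (algB p q))%type /\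
  free_module (A_right p q 1 * A_right p q (-1) : lmodType (algB p q)^c)%type.
Proof.
have p_neq0 : p != 0 by apply: contraNneq p0_neq0 => ->; rewrite horner0.
have xp1 := homog_gen p q gxp; have zp1 := homog_gen p q gzp.
have m11P := m11_homog p q; have m12P := m12_homog p q.
have n22P := n22_homog p q; have m22P : m22 p q \in homog 1 by apply: homogZ.
have inverses := (MN11, MN12, MN21, MN22, NM11, NM12, NM21, NM22).
by split; [apply: (A_left_free q_neq0 p_neq0 zp1 xp1 xp1 m22P m12P n22P m11P m12P)
  | apply: (A_right_free q_neq0 p_neq0 zp1 xp1 xp1 m22P m12P n22P m11P m12P)];
  rewrite inverses.
Qed.
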